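(* Let $k,m$ be integers with $0\le k\le m$ and $m\ge1$. For $0<r<1$, $$\Psi^P(\underline{\mathcal{P}}_{k,m}^{r})=\left\{\left[vx:\sqrt{2-|v|^2}\,y\right]\ :\ v\in\mathbb{H}(\sqrt2),\ \left|v^2+2-|v|^2\right|^2=4(1-r^2),\ x\in S^k,\ y\in S^m\right\}.$$
   Context: $\mathbb{C}P^N(\sqrt2)$ is $\mathbb{C}P^N$ with homogeneous coordinates normalized by $\sum|z_j|^2=2$. $S^k\subset\mathbb{R}^{k+1}$ and $S^m\subset\mathbb{R}^{m+1}$ are unit spheres, $S^0=\{\pm1\}$. $\mathbb{H}(\sqrt2)=\{z\in\mathbb{C}:\mathrm{Im}(z)>0,|z|<\sqrt2\}$. $T^*S^n=\{(p,q)\in\mathbb{R}^{n+1}\times\mathbb{R}^{n+1}:p\cdot q=0,|q|=1\}$, $T^*\mathbb{R}P^n$ is its quotient by $(p,q)\sim(-p,-q)$, and $D_1^*\mathbb{R}P^n=\{|p|<1\}$. $\underline{\mathcal{P}}_{k,m}^r\subset T^*\mathbb{R}P^{k+m+1}$ is the set of all classes of $\big((-r\sin\theta\,x,r\cos\theta\,y),(\cos\theta\,x,\sin\theta\,y)\big)$ with $e^{i\theta}\in S^1$, $x\in S^k$, $y\in S^m$. The map $\Psi^P\colon D_1^*\mathbb{R}P^{k+m+1}\to\mathbb{C}P^{k+m+1}(\sqrt2)$ is $\Psi^P([(p,q)])=\left[\sqrt{f(|p|)}\,p+\frac{i}{\sqrt{f(|p|)}}q\right]$ with $f(t)=\frac{1-\sqrt{1-t^2}}{t^2}$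 for $0<t<1$ and $f(0)=\frac12$. *)

(* Defs.v *)
From HB Require Import structures.
From mathcomp Require Import all_boot all_order all_algebra.
From mathcomp Require Import generic_quotient.
From mathcomp Require Import complex.
From mathcomp Require Import boolp classical_sets reals trigo.
From mathcomp Require Import ring lra.

Set Implicit Arguments.
Unset Strict Implicit.
Unset Printing Implicit Defensive.

Import Order.TTheory GRing.Theory Num.Theory.

Local Open Scope classical_set_scope.
Local Open Scope ring_scope.
Local Open Scope quotient_scope.

(* The norm `|u| that the libraries put on 'rV[R]_n is the sup norm, hence the
   explicit Euclidean structure. *)
Definition dotv (R : realType) (n : nat) (u v : 'rV[R]_n) : R :=
  \sum_j u 0 j * v 0 j.

Definition enorm (R : realType) (n : nat) (u : 'rV[R]_n) : R :=
  Num.sqrt (dotv u u).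

Definition sphere (R : realType) (n : nat) : Type :=
  {x : 'rV[R]_n.+1 | enorm x == 1}.

Lemma dotv_ge0 (R : realType) (n : nat) (u : 'rV[R]_n) : 0 <= dotv u u.
Proof. by apply: sumr_ge0 => j _; rewrite -expr2 sqr_ge0. Qed.

Lemma enorm_sqr (R : realType) (n : nat) (u : 'rV[R]_n) :
  enorm u ^+ 2 = dotv u u.
Proof. by rewrite sqr_sqrtr ?dotv_ge0. Qed.

Lemma enorm_ge0 (R : realType) (n : nat) (u : 'rV[R]_n) : 0 <= enorm u.
Proof. exact: sqrtr_ge0. Qed.

Lemma enormN (R : realType) (n : nat) (u : 'rV[R]_n) : enorm (- u) = enorm u.
Proof.
by congr Num.sqrt; apply: eq_bigr => j _; rewrite !mxE mulrNN.
Qed.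

Lemma dotv_row (R : realType) (n1 n2 : nat) (u1 v1 : 'rV[R]_n1)
    (u2 v2 : 'rV[R]_n2) :
  dotv (row_mx u1 u2) (row_mx v1 v2) = dotv u1 v1 + dotv u2 v2.
Proof.
rewrite /dotv big_split_ord /=; congr (_ + _); apply: eq_bigr => j _.
  by rewrite !row_mxEl.
by rewrite !row_mxEr.
Qed.

Lemma dotvZ (R : realType) (n : nat) (a b : R) (u v : 'rV[R]_n) :
  dotv (a *: u) (b *: v) = a * b * dotv u v.
Proof.
by rewrite /dotv mulr_sumr; apply: eq_bigr => j _; rewrite !mxE mulrACA.
Qed.

Lemma sphere_dot (R : realType) (n : nat) (x : sphere R n) :
  dotv (val x) (val x) = 1.
Proof. by rewrite -enorm_sqr (eqP (valP x)) expr1n. Qed.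

(* T^*S^n, pairs being ordered as (p, q) with p the covector *)
Definition in_cotS (R : realType) (n : nat)
    (pq : 'rV[R]_n.+1 * 'rV[R]_n.+1) : bool :=
  (dotv pq.1 pq.2 == 0) && (enorm pq.2 == 1).

Definition cotS (R : realType) (n : nat) : Type :=
  {pq : 'rV[R]_n.+1 * 'rV[R]_n.+1 | in_cotS pq}.

HB.instance Definition _ (R : realType) (n : nat) := Choice.on (cotS R n).

Definition cotS_eq (R : realType) (n : nat) (a b : cotS R n) : bool :=
  (val b == val a) || (val b == (- (val a).1, - (val a).2)).

Lemma cotS_eq_refl (R : realType) (n : nat) : reflexive (@cotS_eq R n).
Proof. by move=> a; rewrite /cotS_eq eqxx. Qed.

Lemma cotS_eq_sym (R : realType) (n : nat) : symmetric (@cotS_eq R n).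
Proof.
move=> a b; rewrite /cotS_eq eq_sym; congr (_ || _).
by apply/eqP/eqP => ->; rewrite /= !opprK -surjective_pairing.
Qed.

Lemma cotS_eq_trans (R : realType) (n : nat) : transitive (@cotS_eq R n).
Proof.
move=> b a c; rewrite /cotS_eq.
case/orP => /eqP ->; case/orP => /eqP ->; rewrite ?eqxx ?orbT //.
by rewrite /= !opprK -surjective_pairing eqxx.
Qed.

Canonical cotS_equiv (R : realType) (n : nat) : equiv_rel (cotS R n) :=
  EquivRel (@cotS_eq R n) (@cotS_eq_refl R n) (@cotS_eq_sym R n)
    (@cotS_eq_trans R n).

Definition cotRP (R : realType) (n : nat) : Type := {eq_quot cotS_equiv R n}.

HB.instance Definition _ (R : realType) (n : nat) := Choice.on (cotRP R n).
HB.instance Definition _ (R : realType) (n : nat) := EqQuotient.on (cotRP R n).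

Definition cotRP_norm (R : realType) (n : nat) (c : cotRP R n) : R :=
  enorm (val (repr c)).1.

Lemma cotRP_normE (R : realType) (n : nat) (a : cotS R n) :
  cotRP_norm (\pi_(cotRP R n) a) = enorm (val a).1.
Proof.
rewrite /cotRP_norm; case: piP => b /eqmodP; rewrite /= /cotS_eq.
by case/orP => /eqP -> //=; rewrite enormN.
Qed.

Definition D1RP (R : realType) (n : nat) : Type :=
  {c : cotRP R n | cotRP_norm c < 1}.

Definition normalized (R : realType) (n : nat) (z : 'rV[R[i]]_n) : bool :=
  \sum_j `|z 0 j| ^+ 2 == 2.

Definition csphere (R : realType) (n : nat) : Type :=
  {z : 'rV[R[i]]_n.+1 | normalized z}.

HB.instance Definition _ (R : realType) (n : nat) := Choice.on (csphere R n).

(* Two normalized vectors are homogeneous coordinates of the same point; l then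
   has modulus 1 automatically. *)
Definition csphere_eq (R : realType) (n : nat) (z w : csphere R n) : bool :=
  `[< exists2 l : R[i], l != 0 & val w = l *: val z >].

Lemma csphere_eq_refl (R : realType) (n : nat) : reflexive (@csphere_eq R n).
Proof. by move=> z; apply/asboolP; exists 1; rewrite ?oner_eq0 ?scale1r. Qed.

Lemma csphere_eq_sym (R : realType) (n : nat) : symmetric (@csphere_eq R n).
Proof.
by move=> z w; apply/asboolP/asboolP => -[l l0 wE]; exists l^-1;
  rewrite ?invr_eq0 // wE scalerA mulVf // scale1r.
Qed.

Lemma csphere_eq_trans (R : realType) (n : nat) : transitive (@csphere_eq R n).
Proof.
move=> w z u /asboolP[l l0 wE] /asboolP[l' l'0 uE]; apply/asboolP.
by exists (l' * l); rewrite ?mulf_neq0 // uE wE scalerA.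
Qed.

Canonical csphere_equiv (R : realType) (n : nat) : equiv_rel (csphere R n) :=
  EquivRel (@csphere_eq R n) (@csphere_eq_refl R n) (@csphere_eq_sym R n)
    (@csphere_eq_trans R n).

Definition CP (R : realType) (n : nat) : Type := {eq_quot csphere_equiv R n}.

HB.instance Definition _ (R : realType) (n : nat) := Choice.on (CP R n).
HB.instance Definition _ (R : realType) (n : nat) := EqQuotient.on (CP R n).

(* f, meaningful for 0 <= t < 1 *)
Definition psif (R : realType) (t : R) : R :=
  if t == 0 then 1 / 2 else (1 - Num.sqrt (1 - t ^+ 2)) / t ^+ 2.

Lemma psif_gt0 (R : realType) (t : R) : 0 <= t < 1 -> 0 < psif t.
Proof.
move=> /andP[t0 t1]; rewrite /psif; case: eqVneq => [_|tn0]; first by lra.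
have tp : 0 < t by rewrite lt_def tn0.
rewrite divr_gt0 ?exprn_gt0 // subr_gt0.
have s0 : 0 <= Num.sqrt (1 - t ^+ 2) := sqrtr_ge0 _.
have s2 : Num.sqrt (1 - t ^+ 2) ^+ 2 = 1 - t ^+ 2 by rewrite sqr_sqrtr //; nra.
by nra.
Qed.

Lemma psif_norm (R : realType) (t : R) :
  0 <= t < 1 -> psif t * t ^+ 2 + (psif t)^-1 = 2.
Proof.
move=> t01; have f0 := psif_gt0 t01; move: f0 t01 => /[swap] /andP[t0 t1].
rewrite /psif; case: eqVneq => [-> _|tn0].
  by rewrite expr0n mulr0 add0r mul1r invrK.
have t20 : t ^+ 2 != 0 by rewrite expf_neq0.
have s2 : Num.sqrt (1 - t ^+ 2) ^+ 2 = 1 - t ^+ 2 by rewrite sqr_sqrtr //; nra.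
set s := Num.sqrt _ in s2 *; move=> f0.
have s1 : 1 - s != 0.
  by apply/eqP => s1; move: f0; rewrite s1 mul0r ltxx.
have tE : t ^+ 2 = (1 - s) * (1 + s).
  by transitivity (1 - s ^+ 2); [rewrite s2; ring | ring].
rewrite tE mulf_eq0 negb_or in t20 *; case/andP: t20 => _ s1'.
by field; rewrite s1 s1'.
Qed.

Definition psi_vec (R : realType) (n : nat) (p q : 'rV[R]_n) : 'rV[R[i]]_n :=
  let s := (Num.sqrt (psif (enorm p)))%:C%C in
  s *: map_mx (real_complex R) p + ('i%C / s) *: map_mx (real_complex R) q.

Lemma psi_vec_normalized (R : realType) (n : nat) (a : cotS R n) :
  enorm (val a).1 < 1 ->
  normalized (psi_vec (val a).1 (val a).2).
Proof.
case: a => -[p q] /= /andP[_ /eqP q1] p1; rewrite /normalized.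
have p01 : 0 <= enorm p < 1 by rewrite enorm_ge0.
have f0 := psif_gt0 p01; have fE := psif_norm p01.
set f := psif _ in f0 fE.
have sf2 : Num.sqrt f ^+ 2 = f by rewrite sqr_sqrtr // ltW.
have E (j : 'I_n.+1) : `|psi_vec p q 0 j| ^+ 2 =
    (f * (p 0 j * p 0 j) + f^-1 * (q 0 j * q 0 j))%:C%C.
  rewrite /psi_vec -/f !mxE /= -fmorphV.
  have -> : (Num.sqrt f)%:C%C * (p 0 j)%:C%C
            + 'i%C * ((Num.sqrt f)^-1)%:C%C * (q 0 j)%:C%C
          = Complex (Num.sqrt f * p 0 j) ((Num.sqrt f)^-1 * q 0 j).
    by apply/eqP; rewrite eq_complex /=; apply/andP; split; apply/eqP; ring.
  rewrite normc_def /= -rmorphXn /= sqr_sqrtr ?addr_ge0 ?sqr_ge0 //.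
  by rewrite !exprMn exprVn sf2 !expr2.
rewrite (eq_bigr _ (fun j _ => E j)) -rmorph_sum big_split /= -!mulr_sumr.
rewrite -/(dotv p p) -/(dotv q q) -!enorm_sqr q1 expr1n mulr1 fE.
by rewrite rmorph_nat.
Qed.

Definition psi_lift (R : realType) (n : nat) (a : cotS R n)
    (ha : enorm (val a).1 < 1) : csphere R n :=
  exist (fun z => is_true (normalized z)) _ (psi_vec_normalized ha).

(* Defined through the canonical representative; PsiPE gives the value at any
   representative. *)
Definition PsiP (R : realType) (n : nat) (d : D1RP R n) : CP R n :=
  \pi_(CP R n) (@psi_lift R n (repr (val d)) (valP d)).

Lemma PsiPE (R : realType) (n : nat) (a : cotS R n)
    (ha : enorm (val a).1 < 1) (d : D1RP R n) :
  val d = \pi_(cotRP R n) a -> PsiP d = \pi_(CP R n) (psi_lift ha).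
Proof.
move=> dE; apply/eqmodP/asboolP => /=.
have /eqmodP : repr (val d) = a %[mod cotRP R n] by rewrite reprK dE.
rewrite /= /cotS_eq => /orP[] /eqP -> /=.
  by exists 1; rewrite ?oner_eq0 ?scale1r.
exists (-1); first by rewrite oppr_eq0 oner_eq0.
by rewrite /psi_vec enormN !map_mxN !scalerN -opprD scaleN1r.
Qed.

(* The ambient spaces R^(k+1) x R^(m+1) and R^((k+m+1)+1) are identified through
   the conversion k.+1 + m.+1 = (k + m.+1).+1. *)
Definition lag_vec (R : realType) (k m : nat) (r t : R)
    (x : 'rV[R]_k.+1) (y : 'rV[R]_m.+1) :
    'rV[R]_(k + m.+1).+1 * 'rV[R]_(k + m.+1).+1 :=
  (row_mx (- (r * sin t) *: x) ((r * cos t) *: y),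
   row_mx (cos t *: x) (sin t *: y)).

Lemma lag_vec_dot (R : realType) (k m : nat) (r t : R)
    (x : sphere R k) (y : sphere R m) :
  let pq := lag_vec r t (val x) (val y) in
  [/\ dotv pq.1 pq.1 = r ^+ 2, dotv pq.1 pq.2 = 0 & dotv pq.2 pq.2 = 1].
Proof.
have cs := cos2Dsin2 t.
split; rewrite (@dotv_row R k.+1 m.+1) !dotvZ !sphere_dot.
- transitivity (r ^+ 2 * (cos t ^+ 2 + sin t ^+ 2)); last by rewrite cs mulr1.
  by ring.
- by ring.
- by rewrite !mulr1 -!expr2 cs.
Qed.

Lemma lag_vec_cotS (R : realType) (k m : nat) (r t : R)
    (x : sphere R k) (y : sphere R m) :
  in_cotS (lag_vec r t (val x) (val y)).
Proof.
case: (lag_vec_dot r t x y) => _ pq0 qq1.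
by rewrite /in_cotS pq0 /enorm qq1 sqrtr1 !eqxx.
Qed.

Definition lag_pt (R : realType) (k m : nat) (r t : R)
    (x : sphere R k) (y : sphere R m) : cotS R (k + m.+1) :=
  exist (fun pq => is_true (in_cotS pq)) _ (lag_vec_cotS r t x y).

Definition calP (R : realType) (k m : nat) (r : R) :
    set (cotRP R (k + m.+1)) :=
  [set c | exists (t : R) (x : sphere R k) (y : sphere R m),
     c = \pi_(cotRP R (k + m.+1)) (lag_pt r t x y)].

Lemma calP_sub_D1 (R : realType) (k m : nat) (r : R) (c : cotRP R (k + m.+1)) :
  0 < r < 1 -> @calP R k m r c -> cotRP_norm c < 1.
Proof.
move=> /andP[r0 r1] [t [x [y ->]]]; rewrite cotRP_normE /= /enorm.
by case: (lag_vec_dot r t x y) => /= -> _ _; rewrite sqrtr_sqr ger0_norm ?ltW.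
Qed.

Definition Hsqrt2 (R : realType) : Type :=
  {v : R[i] | (0 < complex.Im v) && (`|v| < sqrtC 2)}.

Definition join_vec (R : realType) (k m : nat) (v : R[i])
    (x : 'rV[R]_k.+1) (y : 'rV[R]_m.+1) : 'rV[R[i]]_(k + m.+1).+1 :=
  row_mx (v *: map_mx (real_complex R) x)
         (sqrtC (2 - `|v| ^+ 2) *: map_mx (real_complex R) y).

Lemma sum_scale_sphere (R : realType) (n : nat) (w : R[i]) (x : sphere R n) :
  \sum_j `|(w *: map_mx (real_complex R) (val x)) 0 j| ^+ 2 = `|w| ^+ 2.
Proof.
transitivity (`|w| ^+ 2 * (dotv (val x) (val x))%:C%C); last first.
  by rewrite sphere_dot mulr1.
rewrite rmorph_sum mulr_sumr; apply: eq_bigr => j _.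
rewrite !mxE /= normrM exprMn; congr (_ * _).
by rewrite sqr_normc conjc_real -rmorphM.
Qed.

Lemma sum_row_sqr (R : realType) (n1 n2 : nat) (z1 : 'rV[R[i]]_n1)
    (z2 : 'rV[R[i]]_n2) :
  \sum_j `|row_mx z1 z2 0 j| ^+ 2 =
  \sum_j `|z1 0 j| ^+ 2 + \sum_j `|z2 0 j| ^+ 2.
Proof.
rewrite big_split_ord /=; congr (_ + _); apply: eq_bigr => j _.
  by rewrite row_mxEl.
by rewrite row_mxEr.
Qed.

Lemma join_vec_normalized (R : realType) (k m : nat) (v : Hsqrt2 R)
    (x : sphere R k) (y : sphere R m) :
  normalized (join_vec (val v) (val x) (val y)).
Proof.
case: v => v /= /andP[_ v2]; apply/eqP.
rewrite (@sum_row_sqr R k.+1 m.+1).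
rewrite !sum_scale_sphere -[X in _ + X]normrX sqrtCK [X in _ + X]ger0_norm.
  by rewrite [LHS]addrC subrK.
rewrite subr_ge0 -[leRHS]sqrtCK lerXn2r ?nnegrE ?normr_ge0 ?sqrtC_ge0 //.
exact: ltW.
Qed.

Definition join_pt (R : realType) (k m : nat) (v : Hsqrt2 R)
    (x : sphere R k) (y : sphere R m) : csphere R (k + m.+1) :=
  exist (fun z => is_true (normalized z)) _ (join_vec_normalized v x y).

(* Main.v *)
(* With a = |p| sqrt f and b = 1 / sqrt f at |p| = r, so that a^2 + b^2 = 2 and
   a b = r, Psi sends a point of the Lagrangian to [alpha x : beta y], where
   (alpha, beta) = (- a sin t + i b cos t, a cos t + i b sin t).
   Then alpha^2 + beta^2 = a^2 - b^2, whose square is 4 (1 - r^2), and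
   Im (alpha conj(beta)) = a b > 0; rotating beta onto the positive real axis
   gives (v, sqrt (2 - |v|^2)) with Im v > 0.  Conversely, (v, sqrt (2 - |v|^2))
   is rotated by a phase making the sum of squares equal to a^2 - b^2: the real
   and imaginary parts, as vectors of R^2, are then orthogonal of lengths a and
   b, and Im v > 0 fixes their orientation, which provides t. *)
Require Import Defs.
From mathcomp Require Import all_boot all_order all_algebra.
From mathcomp Require Import generic_quotient complex classical_sets reals.
From mathcomp Require Import boolp trigo ring lra.

Import Order.TTheory GRing.Theory Num.Theory.
Local Open Scope classical_set_scope.
Local Open Scope ring_scope.
Local Open Scope quotient_scope.

Lemma cos_sin_surj {R : realType} (c s : R) :
  c ^+ 2 + s ^+ 2 = 1 -> exists t, cos t = c /\ sin t = s.
Proof.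
move=> cs1; have c11 : -1 <= c <= 1 by apply/andP; split; nra.
have sE : Num.sqrt (1 - c ^+ 2) = `|s|.
  by rewrite -cs1 addrC addKr sqrtr_sqr.
have [s0|s0] := leP 0 s.
  by exists (acos c); rewrite acosK // sin_acos // sE ger0_norm.
exists (- acos c); rewrite cosN sinN acosK // sin_acos // sE ltr0_norm //.
by rewrite opprK.
Qed.

Lemma sqr_norm_complex {R : realType} (z : R[i]) :
  `|z| ^+ 2 = (complex.Re z ^+ 2 + complex.Im z ^+ 2)%:C%C.
Proof.
case: z => x y; rewrite normc_def /= -rmorphXn /=.
by rewrite sqr_sqrtr ?addr_ge0 ?sqr_ge0.
Qed.

Lemma sqrtC_real_sqr {R : realType} {u : R} :
  0 <= u -> sqrtC (u ^+ 2)%:C%C = u%:C%C :> R[i].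
Proof. by move=> u0; rewrite rmorphXn /= sqrCK // lecR. Qed.

Lemma norm_lt_sqrtC2 {R : realType} (v : R[i]) :
  (`|v| < sqrtC 2) = (complex.Re v ^+ 2 + complex.Im v ^+ 2 < 2).
Proof.
rewrite -[LHS](@ltr_pXn2r _ 2) ?nnegrE ?sqrtC_ge0 ?normr_ge0 ?ler0n //.
by rewrite sqrtCK sqr_norm_complex -(rmorph_nat (real_complex R) 2) ltcR.
Qed.

(** The products [s * r] and [s^-1] are the semi-axes a and b of the outline; the last identity is
    [psif_norm] at [r]. *)
Lemma psif_coefs {R : realType} {r : R} : 0 < r < 1 ->
  let s := Num.sqrt (psif r) in
  [/\ 0 < s, 0 < s * r, 0 < s^-1 & (s * r) ^+ 2 + s^-1 ^+ 2 = 2].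
Proof.
move=> /andP[r0 r1] s; have r01 : 0 <= r < 1 by rewrite ltW.
have f0 := psif_gt0 r01; have s0 : 0 < s by rewrite sqrtr_gt0.
split; rewrite ?mulr_gt0 ?invr_gt0 //.
by rewrite exprMn exprVn sqr_sqrtr ?psif_norm // ltW.
Qed.

(** On the Lagrangian |p| is constantly [r], so the coefficients of Psi are constants and [x], [y]
    factor out blockwise. *)
Lemma psi_vec_lag {R : realType} {k m : nat} {r : R} (t : R)
    (x : sphere R k) (y : sphere R m) : 0 < r ->
  let s := Num.sqrt (psif r) in
  psi_vec (lag_vec r t (val x) (val y)).1 (lag_vec r t (val x) (val y)).2 =
  row_mx (Complex (- (s * r * sin t)) (s^-1 * cos t)
            *: map_mx (real_complex R) (val x))
         (Complex (s * r * cos t) (s^-1 * sin t)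
            *: map_mx (real_complex R) (val y)).
Proof.
move=> r0 s; rewrite /psi_vec.
have -> : enorm (lag_vec r t (val x) (val y)).1 = r.
  by rewrite /enorm; case: (lag_vec_dot r t x y) => -> _ _;
    rewrite sqrtr_sqr gtr0_norm.
rewrite -/s /= -fmorphV.
rewrite !(@map_row_mx _ _ _ _ k.+1 m.+1) !(@scale_row_mx _ _ k.+1 m.+1).
rewrite (@add_row_mx _ _ k.+1 m.+1).
congr (@row_mx _ _ k.+1 m.+1 _ _); apply/matrixP => i j; rewrite !mxE;
  by apply/eqP; rewrite eq_complex /=; apply/andP; split; apply/eqP; ring.
Qed.

Lemma ellipse_normalize {R : realType} {a b : R} (t : R) :
  0 < a -> 0 < b -> a ^+ 2 + b ^+ 2 = 2 ->
  exists (v : Hsqrt2 R) (l : R[i]),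
    [/\ l != 0,
        `|val v ^+ 2 + 2 - `|val v| ^+ 2| ^+ 2 =
          (4 * (1 - (a * b) ^+ 2))%:C%C,
        val v = l * Complex (- (a * sin t)) (b * cos t) &
        sqrtC (2 - `|val v| ^+ 2) = l * Complex (a * cos t) (b * sin t)].
Proof.
move=> a0 b0 ab2; have := cos2Dsin2 t.
move: (cos t) (sin t) => c s cs1.
(* This is |beta|^2, positive because [c] and [s] do not vanish together. *)
pose n := (a * c) ^+ 2 + (b * s) ^+ 2.
have n0 : 0 < n.
  rewrite /n; have [c0|c0] := eqVneq c 0.
    have s1 : s ^+ 2 = 1 by rewrite -cs1 c0 expr0n add0r.
    by rewrite c0 mulr0 expr0n add0r exprMn s1 mulr1 exprn_gt0.
  rewrite ltr_wpDr ?sqr_ge0 // exprMn mulr_gt0 ?(exprn_gt0 2 a0) //.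
  by rewrite lt_def sqr_ge0 sqrf_eq0 c0.
pose u := Num.sqrt n.
have u0 : 0 < u by rewrite sqrtr_gt0.
have un : u ^+ 2 = n by rewrite sqr_sqrtr ?ltW.
(* [x] and [y] are the real and imaginary parts of alpha conj(beta) / |beta|; the latter is already
   simplified by c^2 + s^2 = 1. *)
pose x := ((- (a * s)) * (a * c) + (b * c) * (b * s)) / u.
pose y := (a * b) / u.
have y0 : 0 < y by rewrite divr_gt0 ?mulr_gt0.
have uN : u != 0 by rewrite gt_eqF.
have xyu : x ^+ 2 + y ^+ 2 + u ^+ 2 = 2.
  have -> : x ^+ 2 + y ^+ 2 = ((a * s) ^+ 2 + (b * c) ^+ 2).
    apply: (mulIf (expf_neq0 2 uN)); rewrite mulrDl -!exprMn !divfK // un /n.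
    have e : (a * b) ^+ 2 = (a * b * (c ^+ 2 + s ^+ 2)) ^+ 2
      by rewrite cs1 mulr1.
    by rewrite e; ring.
  rewrite un /n.
  transitivity ((a ^+ 2 + b ^+ 2) * (c ^+ 2 + s ^+ 2)); first by ring.
  by rewrite cs1 mulr1.
have vP : (0 < complex.Im (Complex x y)) && (`|Complex x y| < sqrtC 2).
  by rewrite norm_lt_sqrtC2 /= y0 -xyu ltrDl exprn_gt0.
have nE : (2 : R[i]) - `|Complex x y| ^+ 2 = (u ^+ 2)%:C%C.
  rewrite sqr_norm_complex /= -(rmorph_nat (real_complex R) 2) -rmorphB /=.
  by congr (_%:C%C); rewrite -xyu; ring.
(* The phase is conj(beta) / |beta|, which turns beta into [u]. *)
exists (exist (fun v : R[i] => (0 < complex.Im v) && (`|v| < sqrtC 2) : Prop)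
  _ vP), (Complex (a * c / u) (- (b * s / u))).
split => /=.
- rewrite eq_complex /= oppr_eq0; apply/negP => /andP[/eqP e1 /eqP e2].
  have : n = u ^+ 2 * ((a * c / u) ^+ 2 + (b * s / u) ^+ 2).
    by rewrite /n; field.
  by rewrite e1 e2 expr0n addr0 mulr0 => n00; rewrite n00 ltxx in n0.
- rewrite -addrA nE sqr_norm_complex /=; congr (_%:C%C).
  (* In this form both terms are known: the sum is 2 and [y * u] is [a * b]. *)
  transitivity ((x ^+ 2 + y ^+ 2 + u ^+ 2) ^+ 2 - 4 * (y * u) ^+ 2).
    by ring.
  by rewrite xyu /y divfK //; ring.
- apply/eqP; rewrite eq_complex /=; apply/andP; split; apply/eqP.
    by rewrite /x; field.
  have e : a * b = a * b * (c ^+ 2 + s ^+ 2) by rewrite cs1 mulr1.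
  by rewrite /y e; field.
- rewrite nE sqrtC_real_sqr ?ltW //.
  apply/eqP; rewrite eq_complex /=; apply/andP; split; apply/eqP.
    have -> : a * c / u * (a * c) - - (b * s / u) * (b * s) = n / u.
      by rewrite /n; field.
    by rewrite -un; field.
  by field.
Qed.

Lemma half_disc_to_ellipse {R : realType} {a b : R} {v : Hsqrt2 R} :
  0 < a -> 0 < b -> a ^+ 2 + b ^+ 2 = 2 -> a * b < 1 ->
  `|val v ^+ 2 + 2 - `|val v| ^+ 2| ^+ 2 = (4 * (1 - (a * b) ^+ 2))%:C%C ->
  exists (t : R) (l : R[i]),
    [/\ l != 0,
        Complex (- (a * sin t)) (b * cos t) = l * val v &
        Complex (a * cos t) (b * sin t) = l * sqrtC (2 - `|val v| ^+ 2)].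
Proof.
case: v => -[x y] /= /andP[y0]; rewrite norm_lt_sqrtC2 /= => xy2 a0 b0 ab2 ab1.
pose u := Num.sqrt (2 - (x ^+ 2 + y ^+ 2)).
have u0 : 0 < u by rewrite sqrtr_gt0 subr_gt0.
have uE : u ^+ 2 = 2 - (x ^+ 2 + y ^+ 2) by rewrite sqr_sqrtr // subr_ge0 ltW.
have nE : (2 : R[i]) - `|Complex x y| ^+ 2 = (u ^+ 2)%:C%C.
  rewrite sqr_norm_complex /= -(rmorph_nat (real_complex R) 2) -rmorphB /=.
  by rewrite uE.
rewrite -addrA nE sqrtC_real_sqr ?ltW //.
set z : R[i] := _ + _ => zE.
(* The strict bound [a * b < 1] makes [z] nonzero, so that it can be divided by. *)
have d0 : 4 * (1 - (a * b) ^+ 2) != 0.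
  rewrite mulf_neq0 ?pnatr_eq0 // gt_eqF // subr_gt0.
  by rewrite expr_lt1 // mulr_ge0 ?ltW.
have z0 : z != 0.
  apply: contraNneq d0 => z0; move: zE; rewrite z0 normr0 expr0n /= => zE.
  by rewrite -(inj_eq (@complexI R)) /= -zE.
have ab4 : (b ^+ 2 - a ^+ 2) ^+ 2 = 4 * (1 - (a * b) ^+ 2).
  by transitivity ((a ^+ 2 + b ^+ 2) ^+ 2 - 4 * (a * b) ^+ 2);
    [|rewrite ab2]; ring.
(* Either square root would do: replacing [l] by its opposite shifts t by pi. *)
pose l : R[i] := sqrtC ((a ^+ 2 - b ^+ 2)%:C%C / z).
have lz : l ^+ 2 * z = (a ^+ 2 - b ^+ 2)%:C%C by rewrite sqrtCK divfK.
have nl : `|l| ^+ 2 = 1.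
  apply/eqP; rewrite -(@eqrXn2 _ 2) ?exprn_ge0 ?normr_ge0 ?ler01 // expr1n.
  apply/eqP; rewrite -normrX sqrtCK normf_div expr_div_n zE.
  rewrite -normrX -rmorphXn -ab4 ger0_norm ?lecR ?sqr_ge0 //.
  have -> : (a ^+ 2 - b ^+ 2) ^+ 2 = (b ^+ 2 - a ^+ 2) ^+ 2 by ring.
  by rewrite divff // ab4 fmorph_eq0.
have l0 : l != 0.
  by apply/eqP => l0; move: nl; rewrite l0 normr0 expr0n => /esym/eqP;
    rewrite oner_eq0.
move: lz nl; rewrite sqr_norm_complex.
have -> : z = Complex (x ^+ 2 - y ^+ 2 + u ^+ 2) (2 * x * y).
  by apply/eqP; rewrite eq_complex /=; apply/andP; split; apply/eqP; ring.
clearbody l; case: l l0 => p q l0 /= /eqP.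
rewrite eq_complex /= => /andP[/eqP lz1 /eqP lz2].
move=> /(@complexI R) nl.
(* [(a1, b1)] and [(a2, b2)] are the real and imaginary parts of the rotated pair l (v, u). *)
pose a1 := p * x - q * y; pose a2 := p * y + q * x.
pose b1 := p * u; pose b2 := q * u.
have e1 : a1 ^+ 2 + b1 ^+ 2 - (a2 ^+ 2 + b2 ^+ 2) = a ^+ 2 - b ^+ 2.
  by rewrite -lz1 /a1 /a2 /b1 /b2; ring.
have e2 : a1 * a2 + b1 * b2 = 0.
  by apply: (@mulfI _ 2); rewrite ?pnatr_eq0 // mulr0 -lz2 /a1 /a2 /b1 /b2; ring.
have e3 : a1 ^+ 2 + b1 ^+ 2 + (a2 ^+ 2 + b2 ^+ 2) = 2.
  transitivity ((p ^+ 2 + q ^+ 2) * (x ^+ 2 + y ^+ 2 + u ^+ 2)).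
    by rewrite /a1 /a2 /b1 /b2; ring.
  by rewrite nl uE; ring.
have e4 : 0 < a2 * b1 - a1 * b2.
  have -> : a2 * b1 - a1 * b2 = (p ^+ 2 + q ^+ 2) * (y * u).
    by rewrite /a1 /a2 /b1 /b2; ring.
  by rewrite nl mul1r mulr_gt0.
have eA : a1 ^+ 2 + b1 ^+ 2 = a ^+ 2 by lra.
have eB : a2 ^+ 2 + b2 ^+ 2 = b ^+ 2 by lra.
have bN : b != 0 by rewrite gt_eqF.
(* Lagrange's identity; the sign comes from e4. *)
have eD : a2 * b1 - a1 * b2 = a * b.
  apply/eqP; rewrite -(@eqrXn2 _ 2) ?mulr_ge0 ?ltW //; apply/eqP.
  transitivity ((a1 ^+ 2 + b1 ^+ 2) * (a2 ^+ 2 + b2 ^+ 2)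
                - (a1 * a2 + b1 * b2) ^+ 2); first by ring.
  by rewrite eA eB e2; ring.
(* The imaginary part has to be b (cos t, sin t), which determines t; the real part then follows
   from orthogonality and orientation. *)
have [|t [cE sE]] := cos_sin_surj (a2 / b) (b2 / b).
  by rewrite !expr_div_n -mulrDl eB divff ?expf_neq0.
have bA1 : b ^+ 2 * a1 = - (a * b * b2).
  by rewrite -eB -eD; apply/eqP; rewrite -subr_eq0; apply/eqP;
    transitivity (a2 * (a1 * a2 + b1 * b2)); [ring | rewrite e2 mulr0].
have bB1 : b ^+ 2 * b1 = a * b * a2.
  by rewrite -eB -eD; apply/eqP; rewrite -subr_eq0; apply/eqP;
    transitivity (b2 * (a1 * a2 + b1 * b2)); [ring | rewrite e2 mulr0].
have b2N : b ^+ 2 != 0 by rewrite expf_neq0.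
exists t, (Complex p q); rewrite cE sE; split => //;
  apply/eqP; rewrite eq_complex /=; apply/andP; split; apply/eqP.
- by apply: (mulfI b2N); rewrite -/a1 bA1; field.
- by rewrite -/a2; field.
- transitivity b1; last by rewrite /b1; ring.
  by apply: (mulfI b2N); rewrite bB1; field.
- transitivity b2; last by rewrite /b2; ring.
  by field.
Qed.

Theorem proposition7p2 (R : realType) (k m : nat) (r : R) :
  (k <= m)%N -> (1 <= m)%N -> 0 < r < 1 ->
  [set PsiP d | d in [set d : D1RP R (k + m.+1) | @calP R k m r (val d)]] =
  [set c : CP R (k + m.+1) |
    exists (v : Hsqrt2 R) (x : sphere R k) (y : sphere R m),
      `|val v ^+ 2 + 2 - `|val v| ^+ 2| ^+ 2 = (4 * (1 - r ^+ 2))%:C%C /\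
      c = \pi_(CP R (k + m.+1)) (join_pt v x y)].
Proof.
move=> _ _ r01; have /andP[r0 r1] := r01.
have [] := psif_coefs r01; set s := Num.sqrt _ => s0 a0 b0 ab2.
have abr : s * r * s^-1 = r by rewrite mulrAC divff ?mul1r // gt_eqF.
have pn t (x : sphere R k) (y : sphere R m) :
    enorm (val (lag_pt r t x y)).1 < 1.
  rewrite -cotRP_normE; apply: calP_sub_D1 r01 _.
  by exists t, x, y.
apply/seteqP; split => c /=.
- move=> [d [t [x [y dE]]] <-].
  have [v [l [l0 vn vE uE]]] := ellipse_normalize t a0 b0 ab2.
  rewrite abr in vn; exists v, x, y; split=> //.
  rewrite (PsiPE (pn t x y) dE); apply/eqmodP/asboolP; exists l => //.
  rewrite /= psi_vec_lag // /join_vec uE [X in X *: _]vE.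
  by rewrite (@scale_row_mx _ _ k.+1 m.+1) !scalerA.
- move=> [v [x [y [vn ->]]]]; rewrite -abr in vn.
  have ab1 : s * r * s^-1 < 1 by rewrite abr.
  have [t [l [l0 vE uE]]] := half_disc_to_ellipse a0 b0 ab2 ab1 vn.
  have dP : cotRP_norm (\pi_(cotRP R (k + m.+1)) (lag_pt r t x y)) < 1.
    by rewrite cotRP_normE.
  pose d : D1RP R (k + m.+1) := exist (fun c => cotRP_norm c < 1 : Prop) _ dP.
  exists d; first by exists t, x, y.
  rewrite (@PsiPE _ _ _ (pn t x y) d) //.
  (* Here [l] multiplies the join point, not the value of Psi, hence the reversed equality. *)
  apply/esym/eqmodP/asboolP; exists l => //.
  rewrite /= psi_vec_lag // /join_vec vE uE.
  by rewrite (@scale_row_mx _ _ k.+1 m.+1) !scalerA.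
Qed.
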